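(* Let $M\in\mathbb N$. For every $q\in\mathcal I$ the subshift $(\mathbf V_q,\sigma)$ is coded.
   Context: Notation. $\Sigma_M=\{0,\dots,M\}^{\mathbb N}$ with the product topology; $\sigma$ is the one-sided shift; $\prec,\preccurlyeq$ denote the lexicographic order. The reflection of a sequence or word replaces each symbol $x_i$ by $M-x_i$ and is denoted by an overline. For a word $w=w_1\dots w_n$, $w^-=w_1\dots w_{n-1}(w_n-1)$ (if $w_n>0$), $w^+=w_1\dots w_{n-1}(w_n+1)$ (if $w_n<M$), and $w^\infty$ is the infinite concatenation. For $q\in(1,M+1]$, $\alpha(q)\in\Sigma_M$ is the quasi-greedy expansion of $1$ in base $q$: the lexicographically largest $(a_i)\in\Sigma_M$ with infinitely many non-zero terms and $\sum_i a_iq^{-i}=1$. $\mathbf V=\{a\in\Sigma_M:\overline a\preccurlyeq\sigma^n(a)\preccurlyeq a\ \forall n\ge0\}$, $\mathcal V=\{q\in(1,M+1]:\alpha(q)\in\mathbf V\}$, $\mathbf V_q=\{\mathbf x\in\Sigma_M:\overline{\alpha(q)}\preccurlyeq\sigma^n(\mathbf x)\preccurlyeq\alpha(q)\ \forall n\ge0\}$. A sequence $a\in\mathbf V$ is irreducible if $a_1\dots a_j(\overline{a_1\dots a_j}^{\,+})^\infty\prec a$ whenever $(a_1\dots a_j^-)^\infty\in\mathbf V$. $\mathcal I=\{q\in\mathcal V:\alpha(q)\text{ irreducible}\}$. A subshift $(X,\sigma)$ is coded if $X=\overline{\bigcup_{n\ge1}X_n}$ (topological closure), where each $(X_n,\sigma)$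 is a transitive subshift of finite type and $X_n\subset X_{n+1}$ for every $n$. Transitive means: for all words $\upsilon,\nu$ in the language $\mathcal L(X)$ (set of finite factors of elements of $X$) there is $\omega\in\mathcal L(X)$ with $\upsilon\omega\nu\in\mathcal L(X)$. *)

(* Defs.v *)
From HB Require Import structures.
From mathcomp Require Import all_boot all_order all_algebra.
From mathcomp Require Import all_classical all_reals all_analysis.

Set Implicit Arguments.
Unset Strict Implicit.
Unset Printing Implicit Defensive.

Import Order.TTheory GRing.Theory Num.Theory.
Import numFieldNormedType.Exports.

Local Open Scope classical_set_scope.
Local Open Scope ring_scope.

(* Sequences are indexed from 0: [a i] is the term written a_(i+1) on paper. *)
Definition Sigma (M : nat) : Type := nat -> 'I_M.+1.

HB.instance Definition _ (M : nat) := Topological.copy (Sigma M)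
  (prod_topology (fun _ : nat => discrete_topology 'I_M.+1)).

Definition word (M : nat) : Type := seq 'I_M.+1.

Definition shift (M : nat) (x : Sigma M) : Sigma M := fun i => x i.+1.

(* [rev_ord] sends the symbol k of 'I_M.+1 to M - k. *)
Definition reflect_seq (M : nat) (x : Sigma M) : Sigma M :=
  fun i => rev_ord (x i).

Definition reflect_word (M : nat) (w : word M) : word M :=
  [seq rev_ord k | k <- w].

Definition lex_lt (M : nat) (x y : Sigma M) : Prop :=
  exists n : nat, (forall i, (i < n)%N -> x i = y i) /\ (x n < y n)%N.

Definition lex_le (M : nat) (x y : Sigma M) : Prop := lex_lt x y \/ x = y.

Definition map_last (M : nat) (f : nat -> nat) (w : word M) : word M :=
  if w is k :: s then rcons (belast k s) (inord (f (last k s))) else [::].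

(* Only meaningful when the last symbol of the word is positive, resp. smaller
   than M. *)
Definition word_minus (M : nat) : word M -> word M := @map_last M predn.
Definition word_plus (M : nat) : word M -> word M := @map_last M succn.

Definition periodic (M : nat) (w : word M) : Sigma M :=
  fun i => nth ord0 w (i %% size w)%N.

Definition concat (M : nat) (w : word M) (x : Sigma M) : Sigma M :=
  fun i => if (i < size w)%N then nth ord0 w i else x (i - size w)%N.

Definition expansion_of_1 (R : realType) (M : nat) (q : R) (a : Sigma M) :
    Prop :=
  (forall n : nat, exists2 m : nat, (n <= m)%N & a m != ord0) /\
  series (fun i : nat => (nat_of_ord (a i))%:R / q ^+ i.+1) @ \oo --> (1 : R).

Definition is_quasi_greedy (R : realType) (M : nat) (q : R) (a : Sigma M) :
    Prop :=
  expansion_of_1 q a /\ forall b : Sigma M, expansion_of_1 q b -> lex_le b a.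

(* For 1 < q <= M + 1 there is exactly one quasi-greedy expansion; for the other
   values of q, which are never used, [alpha M q] may be the
   default value 0^oo. *)
Definition alpha (R : realType) (M : nat) (q : R) : Sigma M :=
  xget (fun _ => ord0) [set a : Sigma M | is_quasi_greedy q a].

Definition bfV (M : nat) : set (Sigma M) :=
  [set a | forall n : nat,
    lex_le (reflect_seq a) (iter n (@shift M) a) /\
    lex_le (iter n (@shift M) a) a].

Definition calV (R : realType) (M : nat) : set R :=
  [set q | 1 < q <= M.+1%:R /\ bfV (alpha M q)].

Definition bfVq (R : realType) (M : nat) (q : R) : set (Sigma M) :=
  [set x | forall n : nat,
    lex_le (reflect_seq (alpha M q)) (iter n (@shift M) x) /\
    lex_le (iter n (@shift M) x) (alpha M q)].
Arguments bfVq {R} M q.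

(* [mkseq a j.+1] is the word a_1 ... a_(j+1); the hypothesis [0 < a j] is what
   makes the word with its last symbol decreased well defined. *)
Definition irreducible (M : nat) (a : Sigma M) : Prop :=
  bfV a /\
  forall j : nat, (0 < a j)%N ->
    bfV (periodic (word_minus (mkseq a j.+1))) ->
    lex_lt
      (concat (mkseq a j.+1)
         (periodic (word_plus (reflect_word (mkseq a j.+1)))))
      a.

Definition calI (R : realType) (M : nat) : set R :=
  [set q | calV M q /\ irreducible (alpha M q)].

Definition factor (M : nat) (w : word M) (x : Sigma M) : Prop :=
  exists n : nat, w = mkseq (iter n (@shift M) x) (size w).

Definition language (M : nat) (X : set (Sigma M)) : set (word M) :=
  [set w | exists2 x, X x & factor w x].

Definition subshift (M : nat) (X : set (Sigma M)) : Prop :=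
  closed X /\ (@shift M) @` X `<=` X.

Definition finite_type (M : nat) (X : set (Sigma M)) : Prop :=
  exists F : seq (word M), X = [set x | forall w, w \in F -> ~ factor w x].

Definition transitive_subshift (M : nat) (X : set (Sigma M)) : Prop :=
  forall u v : word M, language X u -> language X v ->
    exists w : word M, language X w /\ language X (u ++ w ++ v).

Definition coded (M : nat) (X : set (Sigma M)) : Prop :=
  subshift X /\
  exists Xn : nat -> set (Sigma M),
    [/\ forall n, subshift (Xn n) /\ finite_type (Xn n),
        forall n, transitive_subshift (Xn n),
        forall n, Xn n `<=` Xn n.+1
      & X = closure (\bigcup_n Xn n)].

(* Main.v *)
(** Write a = alpha(q) and A_p = a_1...a_p, and call p admissible when
    (A_p^-)^oo is in V; equivalently (up to the case p = 1) no proper suffix of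
    A_p is the reflection of a prefix of a.  If p is admissible and m is the
    first place where a exceeds A_p (overline(A_p)^+)^oo, then m is again
    admissible and every proper suffix of A_m^- that is the reflection of a
    prefix of a is shorter than p.  Starting from p = 1 or 2 this yields
    admissible lengths g(0) < g(1) < ..., and X_n is the set of sequences all
    of whose windows of length g(n) lie strictly between overline(A_g(n)) and
    A_g(n).
    To leave a finite word u, take its longest suffix that is a prefix of a (or,
    symmetrically, of its reflection), of length in [g(t), g(t+1)), and complete
    it to A_g(t+1)^-: afterwards the longest such suffix is shorter than g(t).
    After finitely many steps these suffixes are so short that any y in X_n may
    follow, possibly after one more symbol; hence X_n is transitive and the
    union of the X_n is dense in V_q.  The only sequences without an admissible
    length are a = k^oo and a = ((k+1)k)^oo, for which V_q is a single periodic
    orbit. *)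

Require Import Defs.
From mathcomp Require Import all_boot all_order all_algebra.
From mathcomp Require Import all_classical all_reals all_analysis.
From mathcomp Require Import zify.
(* Imported again because MathComp-Analysis also defines [shift]. *)
Import Defs.

Set Implicit Arguments.
Unset Strict Implicit.
Unset Printing Implicit Defensive.

Local Open Scope classical_set_scope.
Local Open Scope nat_scope.

(* [x] stays between the reflection of [a] and [a] under all shifts.  The
   lexicographic conditions are spelled out at the first possible difference,
   and [x_j] is the reflection of [a_j] when [x_j + a_j = M]. *)
Definition lex_bounded M (a x : nat -> nat) := forall i k,
  ((forall j, j < k -> x (i + j) = a j) -> x (i + k) <= a k) /\
  ((forall j, j < k -> x (i + j) + a j = M) -> M <= x (i + k) + a k).

(** * Window conditions and splicing *)

Section LexBounds.
Variables (M : nat) (a : nat -> nat).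

(* Windows are strictly between the two bounds when they have full length [N]
   (the term [k.+1 == N]) and weakly when they are cut off by the end of the
   word [x_0 ... x_(L-1)]. *)
Definition window_bounded N L (x : nat -> nat) := forall i k,
  i + k < L -> k < N ->
  ((forall j, j < k -> x (i + j) = a j) -> x (i + k) + (k.+1 == N) <= a k) /\
  ((forall j, j < k -> x (i + j) + a j = M) ->
     M + (k.+1 == N) <= x (i + k) + a k).

Definition strictly_bounded N x := forall L, window_bounded N L x.

Lemma strictly_bounded_digit N y i : 0 < N -> strictly_bounded N y ->
  y i <= a 0 /\ M <= y i + a 0.
Proof.
move=> N0 hy; have [] := hy i.+1 i 0 ltac:(lia) N0; rewrite addn0.
by move=> /(_ ltac:(lia)) h1 /(_ ltac:(lia)) h2; split; lia.
Qed.

(** A window agreeing with [a] or its reflection at its first [N] places already violates strictness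
    at length [N]. *)
Lemma strictly_bounded_mono N N' x : 0 < N -> N <= N' -> strictly_bounded N x ->
  strictly_bounded N' x.
Proof.
move=> N0 NN' hx L i k _ kN.
case: (ltnP k N) => kN1.
  have [h1 h2] := hx (i + k).+1 i k ltac:(lia) kN1.
  by split=> h; [have := h1 h|have := h2 h]; case: eqP; case: eqP; lia.
have [h1 h2] := hx (i + N.-1).+1 i N.-1 ltac:(lia) ltac:(lia).
by split=> h; [have := h1 _|have := h2 _];
  move=> /(_ (fun j jk => h j ltac:(lia))); have := h N.-1 ltac:(lia);
  case: eqP; lia.
Qed.

Lemma strictly_bounded_lex N x : 0 < N -> strictly_bounded N x ->
  lex_bounded M a x.
Proof.
move=> N0 hx i k.
have := @strictly_bounded_mono N (N + k.+1) x N0 ltac:(lia) hx (i + k).+1 i k.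
move=> /(_ ltac:(lia) ltac:(lia))[h1 h2].
by split=> h; [have := h1 h|have := h2 h]; case: eqP; lia.
Qed.

(** No window inside a word shorter than [N] attains full length, so strictness is never tested. *)
Lemma lex_bounded_window N L x : L < N -> lex_bounded M a x ->
  window_bounded N L x.
Proof.
move=> LN hx i k ikL kN; have -> : (k.+1 == N) = false by apply/eqP; lia.
by rewrite !addn0; exact: hx.
Qed.
Definition splice (x : nat -> nat) L y (i : nat) : nat :=
  if i < L then x i else y (i - L).

(* No suffix of length in [d, N) of [x_0 ... x_(L-1)] is a prefix of [a] or of
   its reflection. *)
Definition no_match N d x L := forall l, d <= l -> 0 < l -> l < N -> l <= L ->
  ~ (forall j, j < l -> x (L - l + j) = a j) /\
  ~ (forall j, j < l -> x (L - l + j) + a j = M).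

Lemma spliceL x L y i : i < L -> splice x L y i = x i.
Proof. by rewrite /splice => ->. Qed.
Lemma spliceR x L y i : splice x L y (L + i) = y i.
Proof. by rewrite /splice ltnNge leq_addr addKn. Qed.
Lemma spliceRR x L y i j : splice x L y (L + i + j) = y (i + j).
Proof. by rewrite -addnA spliceR. Qed.

(** A comparison reaching past the junction presupposes that a nonempty suffix of the word matches
    [a] or its reflection. *)
Lemma splice_bounded N x L y : window_bounded N L x -> no_match N 1 x L ->
  strictly_bounded N y -> strictly_bounded N (splice x L y).
Proof.
move=> hx fx hy L' i k _ kN; case: (ltnP i L) => iL; last first.
  have -> : i = L + (i - L) by lia.
  have [h1 h2] := hy (i - L + k).+1 (i - L) k (leqnn _) kN.
  rewrite spliceRR.
  by split=> h; [apply: h1|apply: h2] => j /h; rewrite spliceRR.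
case: (ltnP (i + k) L) => ikL.
  have [h1 h2] := hx i k ikL kN.
  rewrite spliceL //; split=> h; [apply: h1|apply: h2] => j jk; have := h j jk;
    by rewrite spliceL //; lia.
have [f1 f2] := fx (L - i) ltac:(lia) ltac:(lia) ltac:(lia) ltac:(lia).
by split=> h; [case: f1|case: f2] => j jk; have := h j ltac:(lia);
  rewrite subKn ?spliceL; lia.
Qed.

(* The case of two symbols [k], [k+1]: a match of length one is broken by
   following it with the other symbol. *)
Lemma splice_alternating N x L y : M.+1 = a 0 + a 0 -> a 1 = a 0 -> 1 < N ->
  window_bounded N L x -> no_match N 2 x L -> 0 < L -> x L.-1 + y 0 = M ->
  strictly_bounded N y -> strictly_bounded N (splice x L y).
Proof.
move=> a0E a1E N1 hx fx L0 xy hy L' i k _ kN.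
case: (ltnP i L) => iL; last first.
  have -> : i = L + (i - L) by lia.
  have [h1 h2] := hy (i - L + k).+1 (i - L) k (leqnn _) kN.
  rewrite spliceRR.
  by split=> h; [apply: h1|apply: h2] => j /h; rewrite spliceRR.
case: (ltnP (i + k) L) => ikL.
  have [h1 h2] := hx i k ikL kN.
  rewrite spliceL //; split=> h; [apply: h1|apply: h2] => j jk; have := h j jk;
    by rewrite spliceL //; lia.
case: (ltnP i.+1 L) => iL'.
  have [f1 f2] := fx (L - i) ltac:(lia) ltac:(lia) ltac:(lia) ltac:(lia).
  by split=> h; [case: f1|case: f2] => j jk; have := h j ltac:(lia);
    rewrite subKn ?spliceL; lia.
have iE : i = L.-1 by lia.
have LE : i + 1 = L + 0 by lia.
have hk : k = 1 \/ 1 < k by lia.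
split=> h; have := h 0 ltac:(lia); rewrite addn0 spliceL // iE => h0;
  case: hk => k1.
- by rewrite k1 -iE LE spliceR a1E; case: eqP; lia.
- by have := h 1 k1; rewrite LE spliceR a1E; lia.
- by rewrite k1 -iE LE spliceR a1E; case: eqP; lia.
- by have := h 1 k1; rewrite LE spliceR a1E; lia.
Qed.

(** * Admissible lengths and irreducibility *)

(* The symbols of [(a_1 ... a_p)^-], for [i < p]. *)
Definition minus_last p (i : nat) := a i - (i.+1 == p).

(* The sequence of the irreducibility condition for the word [a_1 ... a_p]. *)
Definition reducible_bound p i :=
  if i < p then a i
  else M - a ((i - p) %% p) + (((i - p) %% p).+1 == p).

(** For [p = 1] there is no proper suffix; the bound then says that the reflection of [a 0 - 1] is
    at most [a 0 - 1]. *)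
Definition admissible p :=
  [/\ 0 < p, p = 1 -> M.+2 <= a 0 + a 0
    & forall i, 0 < i -> i < p -> ~ forall j, i + j < p -> a (i + j) + a j = M].

Definition short_mirror_suffixes p m := forall i, 0 < i -> i + p <= m ->
  ~ forall j, i + j < m -> minus_last m (i + j) + a j = M.

Hypothesis a_le : forall i, a i <= M.
Hypothesis aV : lex_bounded M a a.
Hypothesis a0_gt : M < a 0 + a 0.

Lemma aU i k : (forall j, j < k -> a (i + j) = a j) -> a (i + k) <= a k.
Proof. by have [] := aV i k. Qed.
Lemma aL i k : (forall j, j < k -> a (i + j) + a j = M) -> M <= a (i + k) + a k.
Proof. by have [] := aV i k. Qed.

Lemma admissible_last_gt p i k :
  admissible p -> 0 < i -> i + k.+1 = p ->
  (forall j, j < k -> a (i + j) + a j = M) -> M < a (i + k) + a k.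
Proof.
move=> [p0 _ hp] i0 ikp h; have := aL h; rewrite leq_eqVlt => /orP[/eqP e|//].
case: (hp i i0 ltac:(lia)) => j ij; case: (ltnP j k) => jk; first exact: h.
by have -> : j = k by lia.
Qed.

Lemma admissible_last_pos p : admissible p -> 0 < a p.-1.
Proof.
move=> gp; have [p0 p1 _] := gp; case: (ltnP 1 p) => hp; last first.
  have -> : p = 1 by lia. move: a0_gt. simpl. lia.
have := @admissible_last_gt p p.-1 0 gp; rewrite addn0.
move=> /(_ ltac:(lia) ltac:(lia)) h; have : M < a p.-1 + a 0 by apply: h.
have := a_le 0; lia.
Qed.

Lemma minus_last_lt p i : i.+1 < p -> minus_last p i = a i.
Proof. by move=> h; rewrite /minus_last; case: eqP => [|_]; lia. Qed.
Lemma minus_last_last p i : i.+1 = p -> minus_last p i = (a i).-1.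
Proof. by move=> <-; rewrite /minus_last eqxx subn1. Qed.

(** This verifies the premise of irreducibility. Inside a period, use the bounds on [a] and
    admissibility. A match with [a] cannot pass the end of the period, where the symbol was
    lowered. *)
Lemma minus_last_periodic_bounded p : admissible p ->
  let b i := minus_last p (i %% p) in lex_bounded M b b.
Proof.
move=> gp b; have [p0 p1 _] := gp; have lp := admissible_last_pos gp.
have bp i : b (p + i) = b i by rewrite /b modnDl.
have bl i : i.+1 < p -> b i = a i.
  by move=> h; rewrite /b modn_small ?minus_last_lt; lia.
have be i : i.+1 = p -> b i = (a i).-1.
  by move=> h; rewrite /b modn_small ?minus_last_last; lia.
have ble i : i < p -> b i <= a i.
  move=> h; case: (ltnP i.+1 p) => h1; first by rewrite bl.
  by rewrite be; lia.
suff H n k : n < p ->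
    ((forall j, j < k -> b (n + j) = b j) -> b (n + k) <= b k) /\
    ((forall j, j < k -> b (n + j) + b j = M) -> M <= b (n + k) + b k).
  move=> n k; have [] := H (n %% p) k (ltn_pmod _ p0).
  have bn i : b (n %% p + i) = b (n + i) by rewrite /b modnDml.
  move=> h1 h2; split=> h.
    by rewrite -bn; apply: h1 => j jk; rewrite bn; apply: h.
  by rewrite -bn; apply: h2 => j jk; rewrite bn; apply: h.
elim/ltn_ind: k n => k IH n np; case: (posnP n) => [->|n0].
  split=> // h; rewrite add0n; case: (ltnP 1 p) => p2; last first.
    have e1 : p = 1 by lia.
    have bc i : b i = (a 0).-1 by rewrite /b e1 modn1 minus_last_last.
    by rewrite !bc; have := p1 e1; lia.
  case: (posnP k) => [->|k0]; first by rewrite bl //; lia.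
  by have := h 0 k0; rewrite add0n bl //; lia.
case: (ltnP (n + k).+1 p) => nk.
  split=> h; rewrite !bl; try lia; [apply: aU|apply: aL] => j jk;
    have := h j jk; rewrite !bl; lia.
case: (ltnP p (n + k).+1) => nk'; last first.
  have e : n + k.+1 = p by lia.
  split=> h; rewrite (be (n + k)) ?(bl k); try lia.
    have : a (n + k) <= a k; last by lia.
    by apply: aU => j jk; have := h j jk; rewrite !bl; lia.
  have : M < a (n + k) + a k; last by lia.
  apply: (admissible_last_gt gp n0 e) => j jk.
  by have := h j jk; rewrite !bl; lia.
split=> h.
  have := h (p - n.+1) ltac:(lia); rewrite be ?(bl (p - n.+1)); try lia.
  have : a (n + (p - n.+1)) <= a (p - n.+1).
    by apply: aU => j jk; have := h j ltac:(lia); rewrite !bl; lia.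
  have -> : n + (p - n.+1) = p.-1 by lia.
  lia.
(* By periodicity, a reflected match at [n] passing the end of the period is also a shorter one at
   [p - n], with the two sides exchanged. *)
have [_] := IH (k - (p - n)) ltac:(lia) (p - n) ltac:(lia).
rewrite (_ : p - n + (k - (p - n)) = k); last by lia.
rewrite (_ : n + k = p + (k - (p - n))) ?bp; last by lia.
rewrite [b k + _]addnC; apply.
move=> j jk; have := h (p - n + j) ltac:(lia).
by rewrite (_ : n + (p - n + j) = p + j) ?bp; lia.
Qed.

(** A mirrored suffix starting before [p] contradicts admissibility of [p]. From [p] to [D], [a]
    repeats the reflected block with raised last symbol, so a later mirrored suffix is, reflected
    back, a match between a prefix of [a] and a suffix of [A_p]; the raised symbol or the excess at
    [D] rules it out. *)
Lemma admissible_first_diff p D : admissible p ->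
  (forall i, i < D -> a i = reducible_bound p i) -> reducible_bound p D < a D ->
  [/\ p < D.+1, admissible D.+1 & short_mirror_suffixes p D.+1].
Proof.
move=> gp hD gtD; have [p0 p1 hp] := gp; have lp := admissible_last_pos gp.
have pD : p <= D.
  by case: (leqP p D) => // h; move: gtD; rewrite /reducible_bound h ltnn.
have cE t r : r < p ->
    reducible_bound p (p + t * p + r) = M - a r + (r.+1 == p).
  move=> rp; rewrite /reducible_bound ifF; last by lia.
  by rewrite (_ : _ - p = t * p + r) ?modnMDl ?modn_small; lia.
(* [e = 0] is about the suffixes of [A = a_1 ... a_(D+1)], and [e = 1] about
   those of [A^-]. *)
have key e i : e <= 1 -> 0 < i -> i <= D ->
   (e = 1 -> i + p <= D.+1) ->
    ~ (forall j, i + j < D -> a (i + j) + a j = M) \/ a D + a (D - i) <> M + e.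
  move=> e1 i0 iD eD; apply/not_andP => -[h hl].
  case: (ltnP i p) => ip.
    by apply: (hp i i0 ip) => j ij; apply: h; lia.
  pose t := (i - p) %/ p; pose r := (i - p) %% p.
  have iE : i = p + t * p + r by rewrite /t /r -addnA -divn_eq; lia.
  have rp : r < p by rewrite ltn_pmod.
  have cj j : r + j < p ->
    reducible_bound p (i + j) = M - a (r + j) + ((r + j).+1 == p).
    by move=> rj; rewrite -(cE t) // iE addnA.
  have aleM := a_le.
  (* In the first case [D] lies in the block of [i]. For [e = 1] the suffix has length at least [p],
     which only fits if [r = 0]. *)
  case: (leqP (r + (D - i)).+1 p) => Dp.
    have := cj (D - i) Dp; rewrite subnKC // => cD.
    case: (posnP r) => [r0|r0].
      move: cD gtD; rewrite r0 add0n => ->; have := a_le (D - i).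
      by case: eqP; lia.
    have e0 : e = 0 by lia.
    have : a (r + (D - i)) <= a (D - i).
      apply: aU => j jD; have := h j; rewrite hD ?cj; try lia.
      by have := a_le (r + j); have := a_le j; case: eqP; lia.
    by have := a_le (r + (D - i)); lia.
  (* The block of [i] ends before [D]; its raised last symbol forces [a (p - r.+1) = a p.-1 - 1],
     against [aU]. *)
  have : a (r + (p - r.+1)) <= a (p - r.+1).
    apply: aU => j jD; have := h j; rewrite hD ?cj; try lia.
    by have := a_le (r + j); have := a_le j; case: eqP; lia.
  have := h (p - r.+1) ltac:(lia); rewrite hD; last by lia.
  rewrite cj; last by lia.
  rewrite (_ : r + (p - r.+1) = p.-1); last by lia.
  by have := a_le p.-1; have := a_le (p - r.+1); case: eqP; lia.
split; first by lia.
  split=> //; first by lia.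
  move=> i i0 iD h; case: (key 0 i) => //; try lia.
    by apply=> j ij; apply: h; lia.
  by have := h (D - i); rewrite subnKC; try lia; move=> /(_ ltac:(lia)); lia.
move=> i i0 iD h; case: (key 1 i) => //; try lia.
  by apply=> j ij; have := h j; rewrite minus_last_lt; lia.
have := h (D - i); rewrite subnKC; try lia.
by move=> /(_ ltac:(lia)); rewrite minus_last_last //; lia.
Qed.

(** * Removing long matches at the end of a word *)

(** Since the match of length [l] is the longest, no window starting earlier stays matched up to
    [L]. Later windows lie in [A_m^-] and are controlled by the bounds on [a] and admissibility of
    [m]. At the new end, the lowered symbol prevents matches with [a] of length up to [m], and
    [short_mirror_suffixes] the reflected ones of length at least [p]. *)
Lemma complete_match p m N x L l : admissible m -> 1 < m ->
  short_mirror_suffixes p m ->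
  p <= l -> l < m -> m <= N -> l <= L ->
  window_bounded N L x -> no_match N l.+1 x L ->
  (forall j, j < l -> x (L - l + j) = a j) ->
  let x' := splice x (L - l) (minus_last m) in let L' := L - l + m in
  [/\ forall i, i < L -> x' i = x i, window_bounded N L' x'
    & no_match N p x' L'].
Proof.
move=> gm m1 hm pl lm mN lL hx fx; set s := L - l => xa x' L'.
have [sE L'E] : s = L - l /\ L' = s + m by [].
have [m0 _ hm'] := gm; have lp := admissible_last_pos gm.
have eqx i : i < L -> x' i = x i.
  move=> iL; case: (ltnP i s) => si; first by rewrite /x' spliceL.
  have -> : i = s + (i - s) by lia.
  by rewrite /x' spliceR minus_last_lt ?xa; lia.
have x'E i j : x' (s + i + j) = minus_last m (i + j) by rewrite /x' spliceRR.
split=> //.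
  move=> i k ikL' kN; case: (ltnP (i + k) L) => ikL.
    have [h1 h2] := hx i k ikL kN.
    by rewrite eqx //; split=> h; [apply: h1|apply: h2] => j jk; have := h j jk;
      rewrite eqx //; lia.
  case: (ltnP i s) => si.
    have [f1 f2] := fx (L - i) ltac:(lia) ltac:(lia) ltac:(lia) ltac:(lia).
    by split=> h; [case: f1|case: f2] => j jk; have := h j ltac:(lia);
      rewrite subKn ?eqx; lia.
  have -> : i = s + (i - s) by lia.
  move: (i - s) (ltac:(lia) : i - s + k < m) => {si ikL ikL'} i ikm.
  have lowE j : j < k -> minus_last m (i + j) = a (i + j).
    by move=> jk; rewrite minus_last_lt //; lia.
  rewrite x'E; split=> h.
    have : a (i + k) <= a k.
      by apply: aU => j jk; rewrite -lowE // -x'E; apply: h.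
    case: (ltnP (i + k).+1 m) => ikm'.
      by rewrite minus_last_lt //; case: eqP; lia.
    have e : i + k = m.-1 by lia.
    by rewrite minus_last_last; try lia; rewrite e; case: eqP; lia.
  have {}h j : j < k -> a (i + j) + a j = M.
    by move=> jk; rewrite -lowE // -x'E; apply: h.
  case: (posnP i) => i0.
    case: (posnP k) => k0.
      by rewrite i0 k0 addn0 minus_last_lt //; case: eqP; lia.
    by have := h 0 k0; rewrite i0 addn0; lia.
  case: (ltnP (i + k).+1 m) => ikm'.
    by rewrite minus_last_lt //; have := aL h; case: eqP; lia.
  have := admissible_last_gt gm i0 _ h; rewrite minus_last_last; last by lia.
  by case: eqP; lia.
move=> d pd d0 dN dL'; case: (ltnP m d) => md.
  (* A match longer than [m] restricts to a match of the old word longer than [l]. *)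
  have [f1 f2] := fx (L - (L' - d)) ltac:(lia) ltac:(lia) ltac:(lia) ltac:(lia).
  by split=> h; [case: f1|case: f2] => j jk; have := h j ltac:(lia);
    rewrite subKn ?eqx; lia.
have -> : L' - d = s + (m - d) by lia.
case: (ltnP d m) => dm; last first.
  have -> : m - d = 0 by lia.
  split=> h; last by have := h 0 d0; rewrite x'E addn0 minus_last_lt; lia.
  have := h m.-1 ltac:(lia); rewrite x'E minus_last_last; last by lia.
  by rewrite add0n; lia.
split=> h.
  have : a (m - d + d.-1) <= a d.-1.
    apply: aU => j jd; rewrite -(h j); last by lia.
    by rewrite x'E minus_last_lt; lia.
  rewrite -(h d.-1); last by lia.
  rewrite x'E minus_last_last; last by lia.
  by rewrite (_ : m - d + d.-1 = m.-1); lia.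
apply: (hm (m - d)); try lia.
by move=> j jd; rewrite -x'E; apply: h; lia.
Qed.

(** Passing to [mirror x] exchanges matches with [a] and with its reflection, so [complete_match]
    serves both. *)
Definition mirror (x : nat -> nat) i := M - x i.

Lemma window_bounded_le N L x : 0 < N -> window_bounded N L x ->
  forall i, i < L -> x i <= M.
Proof.
move=> N0 hx i iL; have [] := hx i 0 ltac:(lia) N0.
by move=> /(_ ltac:(lia)) h _; have := a_le 0; rewrite addn0 in h; lia.
Qed.

Lemma window_bounded_mirror N L x : 0 < N -> window_bounded N L x ->
  window_bounded N L (mirror x).
Proof.
move=> N0 hx i k ikL kN; have lex := window_bounded_le N0 hx.
have [h1 h2] := hx i k ikL kN; rewrite /mirror; have := lex _ ikL => xM.
have := a_le k => ak.
split=> h.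
  have : M + (k.+1 == N) <= x (i + k) + a k; last by lia.
  by apply: h2 => j jk; have := h j jk; have := lex (i + j) ltac:(lia); lia.
have : x (i + k) + (k.+1 == N) <= a k; last by lia.
by apply: h1 => j jk; have := h j jk; have := lex (i + j) ltac:(lia); lia.
Qed.

Lemma no_match_mirror N d L x : (forall i, i < L -> x i <= M) ->
  no_match N d x L -> no_match N d (mirror x) L.
Proof.
move=> lex fx l dl l0 lN lL; have [f1 f2] := fx l dl l0 lN lL.
split=> h; [apply: f2|apply: f1] => j jl; have := h j jl;
  have := lex (L - l + j) ltac:(lia); have := a_le j; rewrite /mirror; lia.
Qed.

Lemma shorten_matches p m N x L :
  admissible p -> admissible m -> p < m -> m <= N ->
  short_mirror_suffixes p m ->
  window_bounded N L x -> no_match N m x L ->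
  exists x' L', [/\ L <= L', forall i, i < L -> x' i = x i,
    window_bounded N L' x' & no_match N p x' L'].
Proof.
move=> [p0 _ _] gm pm mN hm hx.
(* Lower [l] from [m], keeping [no_match N l x L], until the longest match is found or [p] is
   reached. *)
have : m <= m by []; move: {1 3}m => l; elim: l => [|l IH] lm fx.
  by exists x, L; split=> // d pd; apply: fx; lia.
case: (leqP l.+1 p) => pl.
  by exists x, L; split=> // d pd; apply: fx; lia.
case: (leqP l L) => lL; last first.
  by apply: IH; [lia|move=> d ld d0 dN dL; apply: fx; lia].
have m1 : 1 < m by lia.
have lex := window_bounded_le (ltac:(lia) : 0 < N) hx.
case: (pselect (forall j, j < l -> x (L - l + j) = a j)) => [h1|h1].
  have [h2 h3 h4] := complete_match gm m1 hm pl lm mN lL hx fx h1.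
  by exists (splice x (L - l) (minus_last m)), (L - l + m); split=> //; lia.
case: (pselect (forall j, j < l -> x (L - l + j) + a j = M)) => [h2|h2].
  have hx' := window_bounded_mirror (ltac:(lia) : 0 < N) hx.
  have fx' := no_match_mirror lex fx.
  have h j : j < l -> mirror x (L - l + j) = a j.
    by move=> jl; rewrite /mirror; have := h2 j jl; lia.
  have [h3 h4 h5] := complete_match gm m1 hm pl lm mN lL hx' fx' h.
  exists (mirror (splice (mirror x) (L - l) (minus_last m))), (L - l + m).
  split=> //.
  - by lia.
  - move=> i iL; rewrite /mirror h3 //; have := lex _ iL.
    by rewrite /mirror; lia.
  - by apply: window_bounded_mirror => //; lia.
  - apply: no_match_mirror => //.
    exact: (window_bounded_le (ltac:(lia) : 0 < N) h4).
apply: IH; first by lia.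
move=> d; rewrite leq_eqVlt => /orP[/eqP<-//|]; exact: fx.
Qed.

(** * Joining at the base length and descending the chain *)

Definition base_length p := admissible p /\
  (p = 1 \/ [/\ p = 2, M.+1 = a 0 + a 0 & a 1 = a 0]).

(** For [p = 2] every symbol is [a 0] or its reflection, so a match of length one always remains; it
    is harmless once the other symbol follows. *)
Lemma base_join p N x L y : base_length p -> p <= N ->
  window_bounded N L x -> no_match N p x L -> strictly_bounded N y ->
  exists z K, [/\ L <= K, forall i, i < L -> z i = x i,
    forall i, z (K + i) = y i & strictly_bounded N z].
Proof.
move=> [gp bp] pN hx fx hy.
have triv : strictly_bounded N (splice x L y) -> exists z K, [/\ L <= K,
    forall i, i < L -> z i = x i, forall i, z (K + i) = y i
    & strictly_bounded N z].
  move=> h; exists (splice x L y), L.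
  by split=> // i; [exact: spliceL|exact: spliceR].
case: bp => [p1|[p2 a0E a1E]].
  by apply: triv; apply: splice_bounded => //; rewrite -p1.
case: (posnP L) => L0; first by exists y, 0; split=> //; lia.
have N1 : 1 < N by lia.
have N0 : 0 < N by lia.
rewrite p2 in fx.
have [y1 y2] := strictly_bounded_digit 0 N0 hy.
have [] := hx L.-1 0 ltac:(lia) N0; rewrite addn0 => /(_ ltac:(lia)) x1.
move=> /(_ ltac:(lia)) x2.
case: (eqVneq (x L.-1 + y 0) M) => xy; first exact/triv/splice_alternating.
(* Here [x] ends with [y 0], so the inserted symbol differs from both neighbours. *)
pose y' := splice (fun=> M - y 0) 1 y.
have hy' : strictly_bounded N y'.
  apply: splice_alternating => //; last by lia.
    move=> i k ik kN; have -> : k = 0 by lia.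
    by case: eqP; lia.
  by move=> l l2 _ _ lL; lia.
exists (splice x L y'), L.+1; split.
- by lia.
- by move=> i; exact: spliceL.
- by move=> i; rewrite addSnnS spliceR /y' -[i.+1]add1n spliceR.
- apply: splice_alternating => //; rewrite /y' spliceL //.
  by move/eqP: xy; lia.
Qed.

(** Provides a continuation for finite words in the density argument. For [p = 1] both symbols lie
    strictly inside the bounds; for [p = 2] they alternate, whereas [a] begins with a repeated
    symbol. *)
Lemma strictly_bounded_exists p N : base_length p -> p <= N ->
  strictly_bounded N (fun i => if odd i then M - (a 0).-1 else (a 0).-1).
Proof.
move=> [[p0 p1 _] bp] pN; set y := (X in strictly_bounded _ X) => L i k _ kN.
have aM := a_le 0.
have yE j : y j = M - (a 0).-1 \/ y j = (a 0).-1 by rewrite /y; case: ifP; lia.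
have yS j : y j.+1 + y j = M by rewrite /y /=; case: (odd j) => /=; lia.
case: (posnP k) => [->|k0].
  rewrite addn0; have := yE i.
  by case: bp => [/p1|[pE a0E a1E]]; case: eqP; lia.
case: bp => [/p1 a02|[pE a0E a1E]].
  by split=> /(_ 0 k0); rewrite addn0; have := yE i; lia.
have := yS i; have := yE i; rewrite -addn1 => h1 h2.
case: (ltnP 1 k) => k1.
  by split=> h; have := h 0 k0; have := h 1 k1; rewrite addn0; lia.
have -> : k = 1 by lia.
by split=> /(_ 0 isT); rewrite addn0 a1E; case: eqP; lia.
Qed.

Hypothesis irreducible_a : forall p, admissible p ->
  exists D, (forall i, i < D -> a i = reducible_bound p i) /\
    reducible_bound p D < a D.

Lemma admissible_chain p : admissible p -> exists g : nat -> nat, [/\ g 0 = p,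
  forall t, admissible (g t), forall t, g t < g t.+1
  & forall t, short_mirror_suffixes (g t) (g t.+1)].
Proof.
move=> gp.
have /choice[f hf] : forall p, exists m, admissible p -> [/\ p < m, admissible m
    & short_mirror_suffixes p m].
  move=> r; case: (pselect (admissible r)) => [gr|]; last by exists 0.
  have [D [h1 h2]] := irreducible_a gr.
  by exists D.+1 => _; exact: admissible_first_diff.
have gg t : admissible (iter t f p) by elim: t => //= t /hf[].
exists (fun t => iter t f p); split=> // t; by have [] := hf _ (gg t).
Qed.

Lemma bridge (g : nat -> nat) n x L y : base_length (g 0) ->
  (forall t, admissible (g t)) -> (forall t, g t < g t.+1) ->
  (forall t, short_mirror_suffixes (g t) (g t.+1)) ->
  window_bounded (g n) L x -> strictly_bounded (g n) y ->
  exists z K, [/\ L <= K, forall i, i < L -> z i = x i,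
    forall i, z (K + i) = y i & strictly_bounded (g n) z].
Proof.
move=> b0 gg gS hg hx hy.
have gm := homo_leq leqnn leq_trans (fun t => ltnW (gS t)).
(* No length is tested at the start; each step lowers the threshold from [g t.+1] to [g t]. *)
have : no_match (g n) (g n) x L by move=> l; lia.
have : n <= n by []; move: {1 4}n => t; elim: t => [|t IH] in x L hx * => tn fx.
  exact: (base_join b0 (gm _ _ (leq0n n)) hx fx hy).
have [x' [L' [LL' eqx hx' fx']]] :=
  shorten_matches (gg t) (gg t.+1) (gS t) (gm _ _ tn) (hg t) hx fx.
have [z [K [LK eqz zK hz]]] := IH x' L' hx' (ltnW tn) fx'.
exists z, K; split=> //; first by lia.
by move=> i iL; rewrite eqz ?eqx //; lia.
Qed.

End LexBounds.

(** * Closure and finite type in the space of sequences *)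

Lemma closure_SigmaP M (S : set (Sigma M)) (x : Sigma M) :
  closure S x <-> forall n, exists2 y, S y & forall i, i < n -> y i = x i.
Proof.
split=> [clx n|h].
  have : nbhs x [set y : Sigma M | forall i, i < n -> y i = x i].
    elim: n => [|n IH]; first exact: filterS filterT.
    have : nbhs x [set y : Sigma M | y n = x n].
      exact: (@proj_continuous nat (fun=> discrete_topology 'I_M.+1) n x
        [set x n] (@discrete_set1 (discrete_topology 'I_M.+1) (x n))).
    move/(filterI IH); apply: filterS => y [/= h1 h2] i.
    by rewrite ltnS leq_eqVlt => /orP[/eqP->//|]; exact: h1.
  by move/clx => [y [Sy hy]]; exists y.
have /choice[u hu] : forall n, exists y, S y /\ forall i, i < n -> y i = x i.
  by move=> n; have [y] := h n; exists y.
have cvgu : u @ \oo --> x.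
  apply/cvg_sup => i U [V] [[W] oW <-] Wx WU.
  apply: (filterS WU); exists i.+1 => // n /= ltin.
  by have [_ /(_ i ltin)] := hu n; rewrite /preimage /= => ->.
move=> B /cvgu[n _ nB]; exists (u n).
by split; [have [] := hu n|exact: (nB n (leqnn n))].
Qed.

Lemma iter_shiftE M (x : Sigma M) n i : iter n (@shift M) x i = x (n + i).
Proof. by elim: n i => //= n IH i; rewrite /shift IH addnS. Qed.

(** A test on windows of fixed length yields closedness, shift invariance and finite type
    together. *)
Definition window_shift M N (P : pred (word M)) : set (Sigma M) :=
  [set x | forall i, P (mkseq (iter i (@shift M) x) N)].

Lemma mkseq_iter_shift M (x y : Sigma M) i N :
  (forall j, j < i + N -> y j = x j) ->
  mkseq (iter i (@shift M) y) N = mkseq (iter i (@shift M) x) N.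
Proof.
move=> h; apply/eq_in_map => j; rewrite mem_iota add0n => /andP[_ jN].
by rewrite !iter_shiftE h // ltn_add2l.
Qed.

Lemma window_shift_subshift M N (P : pred (word M)) :
  subshift (window_shift N P).
Proof.
split; last by move=> _ [x hx <-] i; rewrite -iterSr; exact: hx.
apply/closure_id; apply/seteqP; split; first exact: subset_closure.
move=> x /closure_SigmaP clx i; have [y hy /mkseq_iter_shift <-] := clx (i + N).
exact: hy.
Qed.

Lemma window_shift_finite_type M N (P : pred (word M)) :
  finite_type (window_shift N P).
Proof.
exists [seq w <- [seq val t | t : N.-tuple 'I_M.+1] | ~~ P w].
apply/seteqP; split=> [x hx w|x hx i].
  rewrite mem_filter => /andP[nPw /mapP[t _ wt]] [n wE].
  by move: nPw; rewrite wE wt size_tuple hx.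
apply: contrapT => /negP nP.
have sz : size (mkseq (iter i (@shift M) x) N) == N by rewrite size_mkseq.
apply: (hx (mkseq (iter i (@shift M) x) N)).
  rewrite mem_filter nP; apply/mapP.
  by exists (Tuple sz) => //; rewrite mem_enum.
by exists i; rewrite size_mkseq.
Qed.

(** * Lexicographic conditions in terms of digits *)

Lemma lex_leP M (x y : Sigma M) : lex_le x y <->
  forall k, (forall j, j < k -> x j = y j :> nat) -> x k <= y k.
Proof.
split=> [[[n [eqn ltn]] k h|->//]|h].
  have [kn|nk|->] := ltngtP k n; last exact: ltnW.
    by rewrite eqn.
  by move: ltn; rewrite h // ltnn.
have [[n0 n0P]|eqxy] := pselect (exists n, x n != y n); last first.
  right; apply/funext => n; apply/eqP/negPn/negP => nP.
  by apply: eqxy; exists n.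
have /ex_minnP[n xyn nmin] : exists n, x n != y n by exists n0.
have eqn i : i < n -> x i = y i.
  by move=> lin; apply/eqP; case: eqP => // /eqP /nmin; rewrite leqNgt lin.
left; exists n; split=> //; rewrite ltn_neqAle xyn h // => j jn.
by rewrite eqn.
Qed.

Definition digits M (x : Sigma M) (i : nat) : nat := x i.

Lemma digits_le M (x : Sigma M) i : digits x i <= M.
Proof. by rewrite -ltnS ltn_ord. Qed.

Lemma lex_boundedP M (a x : Sigma M) : lex_bounded M (digits a) (digits x) <->
  forall n, lex_le (reflect_seq a) (iter n (@shift M) x) /\
    lex_le (iter n (@shift M) x) a.
Proof.
have revE j : reflect_seq a j = M - digits a j :> nat by rewrite /= subSS.
split=> h n.
  by split; apply/lex_leP => k hk; rewrite iter_shiftE ?revE;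
    have [h1 h2] := h n k;
    [rewrite leq_subLR addnC; apply: h2|apply: h1] => j /hk;
    rewrite iter_shiftE // revE /digits => <-; rewrite subnK //;
    exact: digits_le.
move=> k; have [/lex_leP/(_ k) h1 /lex_leP/(_ k) h2] := h n.
move: h1 h2; rewrite revE iter_shiftE => h1 h2; split=> hk.
  by apply: h2 => j jk; rewrite iter_shiftE; exact: hk.
rewrite addnC -leq_subLR; apply: h1 => j jk.
by have := hk j jk; rewrite revE iter_shiftE /digits; lia.
Qed.

Lemma nth_map_last M (f : nat -> nat) (w : word M) i : i < size w ->
  nth ord0 (map_last f w) i =
  if i.+1 == size w then inord (f (nth ord0 w i)) else nth ord0 w i.
Proof.
case: w => // k s; rewrite [in nth _ (k :: s)]lastI /map_last /= !nth_rcons.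
rewrite !size_belast eqSS ltnS leq_eqVlt.
by case: eqP => [->|] //=; rewrite ?ltnn // => _ ->.
Qed.

Lemma nth_word_minus M (x : Sigma M) p i : i < p ->
  nth ord0 (word_minus (mkseq x p)) i = minus_last (digits x) p i :> nat.
Proof.
move=> ip; rewrite nth_map_last size_mkseq // nth_mkseq // /minus_last.
case: eqP => _; last by rewrite subn0.
by rewrite inordK ?subn1 // ltnS (leq_trans (leq_pred _)) // digits_le.
Qed.

Lemma nth_word_plus M (x : Sigma M) p i : i < p -> 0 < x p.-1 ->
  nth ord0 (word_plus (reflect_word (mkseq x p))) i =
  M - digits x i + (i.+1 == p) :> nat.
Proof.
move=> ip x0; have sp : size (reflect_word (mkseq x p)) = p.
  by rewrite size_map size_mkseq.
rewrite nth_map_last sp // (nth_map ord0) ?size_mkseq // nth_mkseq //= subSS.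
case: eqP => [ipE|_]; last by rewrite /= subSS addn0.
have := digits_le x p.-1; rewrite /digits (_ : i = p.-1); last by lia.
by move=> h; rewrite inordK ?addn1 // ltnS; lia.
Qed.

Lemma size_map_last M f (w : word M) : size (map_last f w) = size w.
Proof. by case: w => // k s; rewrite /= size_rcons size_belast. Qed.

(** The premise of irreducibility holds by [minus_last_periodic_bounded]; [D] is the first
    difference in its strict inequality. *)
Lemma irreducible_first_diff M (a : Sigma M) p : irreducible a ->
  M < digits a 0 + digits a 0 -> admissible M (digits a) p ->
  exists D,
    (forall i, i < D -> digits a i = reducible_bound M (digits a) p i) /\
    reducible_bound M (digits a) p D < digits a D.
Proof.
move=> [aV irr] a0 gp; have [p0 _ _] := gp.
have /lex_boundedP aL := aV.
have lp := admissible_last_pos (@digits_le M a) aL a0 gp.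
have pE : p.-1.+1 = p by lia.
have := irr p.-1 lp; rewrite pE => {}irr.
have /irr[D [hD ltD]] : bfV (periodic (word_minus (mkseq a p))).
  apply/lex_boundedP.
  rewrite (_ : digits _ = fun i => minus_last (digits a) p (i %% p)).
    exact: (minus_last_periodic_bounded (@digits_le M a) aL a0 gp).
  apply/funext => i; rewrite /digits /periodic size_map_last size_mkseq.
  by rewrite nth_word_minus // ltn_pmod.
have cE i :
    concat (mkseq a p) (periodic (word_plus (reflect_word (mkseq a p)))) i =
    reducible_bound M (digits a) p i :> nat.
  rewrite /concat /reducible_bound size_mkseq; case: ltnP => ip.
    by rewrite nth_mkseq.
  rewrite /periodic size_map_last size_map size_mkseq nth_word_plus //.
  by rewrite ltn_pmod.
by exists D; split=> [i iD|]; rewrite -cE // hD.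
Qed.

(** * The approximating shifts and transitivity *)

Definition strict_windows M (a : Sigma M) N : set (Sigma M) :=
  [set x | strictly_bounded M (digits a) N (digits x)].

Definition strict_word M (a : Sigma M) N (w : word M) : bool :=
  `[< forall k, k < N ->
    ((forall j, j < k -> nth ord0 w j = a j :> nat) ->
       nth ord0 w k + (k.+1 == N) <= a k) /\
    ((forall j, j < k -> nth ord0 w j + a j = M) ->
       M + (k.+1 == N) <= nth ord0 w k + a k) >].

Lemma strict_windowsE M (a : Sigma M) N :
  strict_windows a N = window_shift N (strict_word a N).
Proof.
apply/seteqP; split=> x hx.
  move=> i; apply/asboolP => k kN; rewrite nth_mkseq // iter_shiftE.
  have [h1 h2] := hx (i + k).+1 i k (leqnn _) kN.
  by split=> h; [apply: h1|apply: h2] => j jk; have := h j jk;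
    rewrite nth_mkseq ?iter_shiftE //; exact: ltn_trans kN.
move=> L i k _ kN; have /asboolP/(_ k kN) := hx i.
rewrite nth_mkseq // iter_shiftE => -[h1 h2].
by split=> h; [apply: h1|apply: h2] => j jk;
  rewrite nth_mkseq ?iter_shiftE; try exact: h; exact: ltn_trans kN.
Qed.

Lemma strict_windows_shift M (a : Sigma M) N x n : strict_windows a N x ->
  strict_windows a N (iter n (@shift M) x).
Proof.
rewrite strict_windowsE => hx; elim: n => //= n IH.
have [_] := window_shift_subshift N (strict_word a N); apply.
by exists (iter n (@shift M) x).
Qed.

Lemma language_iter M (X : set (Sigma M)) x n p : X x ->
  language X (mkseq (iter n (@shift M) x) p).
Proof. by move=> Xx; exists x => //; exists n; rewrite size_mkseq. Qed.

Lemma mkseq_cat M (x : Sigma M) p r :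
  mkseq x p ++ mkseq (iter p (@shift M) x) r = mkseq x (p + r).
Proof.
rewrite /mkseq iotaD map_cat add0n; congr (_ ++ _).
have := iotaDl p 0 r; rewrite addn0 => ->; rewrite -map_comp.
by apply: eq_map => i; rewrite /= iter_shiftE.
Qed.

(** The connecting word is read off [z] between the end of [u] and the place [K] where [y]
    begins. *)
Lemma transitive_subshift_glue M (X : set (Sigma M)) :
  (forall x, X x -> X (shift x)) ->
  (forall x y L, X x -> X y -> exists z K,
     [/\ L <= K, X z, forall i, i < L -> z i = x i
       & forall i, z (K + i) = y i]) ->
  transitive_subshift X.
Proof.
move=> sX glue u v [x Xx [n ->]] [y Xy [m ->]].
have sXn w k : X w -> X (iter k (@shift M) w).
  by move=> Xw; elim: k => //= k; exact: sX.
have [z [K [LK Xz zx zy]]] := glue _ _ (size u) (sXn x n Xx) (sXn y m Xy).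
exists (mkseq (iter (size u) (@shift M) z) (K - size u)); split.
  exact: language_iter.
exists z => //; exists 0; rewrite /= !size_cat !size_mkseq.
rewrite -!mkseq_cat; congr (_ ++ _).
  by apply/eq_in_map => i; rewrite mem_iota add0n => /andP[_ /zx].
congr (_ ++ _); apply/eq_map => i.
by rewrite -zy !iter_shiftE addnA subnKC.
Qed.

(** This is V_q with an arbitrary [a] in place of alpha(q), which removes [q] from the argument. *)
Definition lex_shift M (a : Sigma M) : set (Sigma M) :=
  [set x | forall n, lex_le (reflect_seq a) (iter n (@shift M) x) /\
                     lex_le (iter n (@shift M) x) a].

Lemma lex_shift_stable M (a : Sigma M) :
  (@shift M) @` lex_shift a `<=` lex_shift a.
Proof. by move=> _ [x hx <-] n; rewrite -iterSr; exact: hx. Qed.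

(** * Sequences with an admissible base length *)

Section Nondegenerate.
Variables (M p : nat) (a : Sigma M).
Hypothesis irr : irreducible a.
Hypothesis base_p : base_length M (digits a) p.
Hypothesis a0_gt : M < digits a 0 + digits a 0.

Let aL : lex_bounded M (digits a) (digits a).
Proof. by apply/lex_boundedP; have [] := irr. Qed.

Lemma bridge_Sigma (g : nat -> nat) n (x y : Sigma M) L : g 0 = p ->
  (forall t, admissible M (digits a) (g t)) -> (forall t, g t < g t.+1) ->
  (forall t, short_mirror_suffixes M (digits a) (g t) (g t.+1)) ->
  window_bounded M (digits a) (g n) L (digits x) -> strict_windows a (g n) y ->
  exists z K, [/\ L <= K, strict_windows a (g n) z,
    forall i, i < L -> z i = x i & forall i, z (K + i) = y i].
Proof.
move=> g0 gg gS hg hx hy.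
have base_g : base_length M (digits a) (g 0) by rewrite g0.
have [z [K [LK zx zy hz]]] :=
  bridge (@digits_le M a) aL a0_gt base_g gg gS hg hx hy.
have gn0 : 0 < g n by have [] := gg n.
(* This bound ensures that [inord] preserves the values of [z]. *)
have zM i : z i <= M.
  apply: leq_trans (digits_le a 0).
  by have [] := strictly_bounded_digit i gn0 hz.
pose w : Sigma M := fun i => inord (z i).
have wE : digits w = z by apply/funext => i; rewrite /digits inordK ?ltnS.
exists w, K; split=> //; first by rewrite /strict_windows /= wE.
  by move=> i iL; apply/val_inj; rewrite /= -[RHS]zx // -wE.
by move=> i; apply/val_inj; rewrite /= -[RHS]zy -wE.
Qed.

Lemma coded_nondegenerate : coded (lex_shift a).
Proof.
have [g [g0 gg gS hg]] := admissible_chain (@digits_le M a) aL a0_gt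
  (fun p gp => irreducible_first_diff irr a0_gt gp) (base_p.1).
have gm := homo_leq leqnn leq_trans (fun t => ltnW (gS t)).
have g_pos n : 0 < g n by have [] := gg n.
have gid n : n <= g n by elim: n => // n IH; exact: leq_ltn_trans (gS n).
have VE : lex_shift a = closure (\bigcup_n strict_windows a (g n)).
  apply/seteqP; split=> x.
    move=> /lex_boundedP hx; apply/closure_SigmaP => n.
    (* As [n < g n.+1], the weak bounds of [lex_shift a] suffice for the prefix of length [n]. *)
    have hw := lex_bounded_window (gid n.+1) hx.
    pose f i := if odd i then M - (digits a 0).-1 else (digits a 0).-1.
    pose y : Sigma M := fun i => inord (f i).
    have hy : strict_windows a (g n.+1) y.
      rewrite /strict_windows /= (_ : digits y = f).
        apply: (strictly_bounded_exists (@digits_le M a) a0_gt base_p).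
        by rewrite -g0; exact: gm.
      apply/funext => i; rewrite /digits inordK // ltnS /f.
      case: ifP => _; first exact: leq_subr.
      by rewrite (leq_trans (leq_pred _)) // digits_le.
    have [z [K [_ hz zx _]]] := bridge_Sigma g0 gg gS hg hw hy.
    by exists z => //; exists n.+1.
  move=> /closure_SigmaP clx; apply/lex_boundedP => i k.
  have [y [n _ hy] yx] := clx (i + k).+1.
  have {}yx j : j <= i + k -> digits x j = digits y j.
    by move=> /yx; rewrite /digits => ->.
  have [h1 h2] := strictly_bounded_lex (g_pos n) hy i k.
  rewrite yx //; split=> h; [apply: h1|apply: h2] => j jk; rewrite -yx ?h //;
    by rewrite leq_add2l ltnW.
split.
  split; last exact: lex_shift_stable.
  by rewrite VE; exact: closed_closure.
exists (fun n => strict_windows a (g n)); split=> // n.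
- rewrite strict_windowsE; split; first exact: window_shift_subshift.
  exact: window_shift_finite_type.
- apply: transitive_subshift_glue => [x hx|x y L hx hy].
    exact: (strict_windows_shift 1 hx).
  exact: (bridge_Sigma g0 gg gS hg (hx L) hy).
- by move=> x; apply: strictly_bounded_mono => //; exact: gm.
Qed.

End Nondegenerate.

(** * The two exceptional kinds of sequences *)

Definition alternating_word M (c : 'I_M.+1) (w : word M) :=
  (nth ord0 w 1 == rev_ord (nth ord0 w 0)) &&
  ((nth ord0 w 0 == c) || (nth ord0 w 0 == rev_ord c)).

Lemma alternatingP M (c : 'I_M.+1) (x : Sigma M) :
  window_shift 2 (alternating_word c) x <->
  forall i, x i.+1 = rev_ord (x i) /\ (x i = c \/ x i = rev_ord c).
Proof.
by split=> h i; have := h i;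
  rewrite /alternating_word /= !iter_shiftE addn0 addn1;
  [move=> /andP[/eqP -> /orP[]/eqP ->]; split=> //; [left|right]
  |move=> [-> [] ->]; rewrite !eqxx ?orbT].
Qed.

Section Degenerate.
Variables (M : nat) (a : Sigma M).
Hypothesis aL : lex_bounded M (digits a) (digits a).
Hypothesis a0_deg : digits a 0 + digits a 0 = M \/
  digits a 0 + digits a 0 = M.+1 /\ digits a 1 + digits a 0 = M.

(** The bounds force each symbol to be [a 0] or its reflection, followed by its own reflection.
    Conversely such an [x] coincides from any place on with [a] or its reflection. *)
Lemma lex_shift_degenerate :
  lex_shift a = window_shift 2 (alternating_word (a 0)).
Proof.
have revE (c : 'I_M.+1) : rev_ord c = M - c :> nat by rewrite /= subSS.
have alt (x : Sigma M) : lex_bounded M (digits a) (digits x) -> forall i,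
    digits x i.+1 + digits x i = M /\
    (digits x i = digits a 0 \/ digits x i + digits a 0 = M).
  move=> hx i.
  have b j : digits x j <= digits a 0 /\ M <= digits x j + digits a 0.
    by have [h1 h2] := hx j 0; rewrite -[in digits x j](addn0 j); split;
      [apply: h1|apply: h2].
  have [b1 b2] := b i; have [b3 b4] := b i.+1.
  have [h1 h2] := hx i 1; rewrite addn1 in h1 h2.
  case: a0_deg => [|[e1 e2]]; first by lia.
  have u1 : digits x i = digits a 0 -> digits x i.+1 <= digits a 1.
    by move=> e; apply: h1 => -[|//] _; rewrite addn0.
  have u2 : digits x i + digits a 0 = M -> M <= digits x i.+1 + digits a 1.
    by move=> e; apply: h2 => -[|//] _; rewrite addn0.
  have [e|e] : digits x i = digits a 0 \/ digits x i + digits a 0 = M by lia.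
    by have := u1 e; lia.
  by have := u2 e; lia.
have aA := alt a aL.
apply/seteqP; split=> x.
  move=> /lex_boundedP/alt hx; apply/alternatingP => i.
  have [] := hx i; rewrite /digits => h1 h2.
  split; first by apply/ord_inj; rewrite revE; lia.
  by case: h2 => h2; [left|right]; apply/ord_inj; rewrite ?revE; lia.
move=> /alternatingP hx; apply/lex_boundedP => i k.
have xA j : digits x j.+1 + digits x j = M.
  by rewrite /digits (hx j).1 revE subnK //; exact: digits_le.
have x0 : digits x i = digits a 0 \/ digits x i + digits a 0 = M.
  have [_ [e|e]] := hx i; [left|right]; rewrite /digits e // revE subnK //.
  exact: digits_le.
have eqxa : digits x i = digits a 0 -> forall j, digits x (i + j) = digits a j.
  move=> e; elim=> [|j IH]; first by rewrite addn0.
  by have [] := aA j; have := xA (i + j); rewrite addnS; lia.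
have neqxa : digits x i + digits a 0 = M ->
    forall j, digits x (i + j) + digits a j = M.
  move=> e; elim=> [|j IH]; first by rewrite addn0.
  by have [] := aA j; have := xA (i + j); rewrite addnS; lia.
have ac : digits a 0 + digits a 0 = M -> forall j, digits a j = digits a 0.
  by move=> e j; have [_] := aA j; lia.
(* A nonempty match of the kind opposite to [e] forces [2 * a 0 = M], and then [a] is constant. *)
case: x0 => e; split=> h.
- by rewrite eqxa.
- rewrite eqxa //; have [k0|k0] := posnP k; first by rewrite k0; lia.
  have := h 0 k0; rewrite addn0 e => /[dup] /ac ->; lia.
- have [k0|k0] := posnP k; first by have := neqxa e 0; rewrite k0 addn0; lia.
  have := h 0 k0; rewrite addn0 => e'.
  have /ac aE : digits a 0 + digits a 0 = M by lia.
  by have := neqxa e k; rewrite aE; lia.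
- by rewrite neqxa.
Qed.

(** A constant family suffices. For gluing, [y 0] is [x L] or its reflection [x L.+1], so at most
    one extra symbol is needed. *)
Lemma coded_degenerate : coded (lex_shift a).
Proof.
rewrite lex_shift_degenerate; set X := window_shift _ _.
have sX : subshift X by exact: window_shift_subshift.
split=> //; exists (fun=> X); split=> [n|n|n //|].
- by split=> //; exact: window_shift_finite_type.
- apply: transitive_subshift_glue => [x Xx|x y L /[dup] Xx /alternatingP hx
    /alternatingP hy].
    by apply: sX.2; exists x.
  have tail K : y 0 = x K -> forall i, x (K + i) = y i.
    move=> e; elim=> [|i IH]; first by rewrite addn0.
    by rewrite addnS (hx _).1 (hy _).1 IH.
  have [e|e] : y 0 = x L \/ y 0 = x L.+1.
    rewrite (hx L).1; have [_ [->|->]] := hx L; have [_ [->|->]] := hy 0;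
      rewrite ?rev_ordK; by [left|right].
    by exists x, L; split=> //; exact: tail.
  by exists x, L.+1; split=> //; exact: tail.
- rewrite bigcup_const; last by exists 0.
  by apply/closure_id; exact: sX.1.
Qed.

End Degenerate.

(** * Case distinction on the first two symbols *)

(** Membership in V gives [M <= 2 * a 0] and [M - a 0 <= a 1 <= a 0]; when [2 * a 0 = M + 1], [a 1]
    is thus [a 0] (base length 2) or its reflection (exceptional). *)
Lemma coded_lex_shift M (a : Sigma M) : irreducible a -> coded (lex_shift a).
Proof.
move=> irr; have /lex_boundedP aL := irr.1.
have [h1 h2] := aL 1 0; have [_ h3] := aL 0 0.
rewrite !addn0 in h1 h2 h3.
have {}h1 : digits a 1 <= digits a 0 by apply: h1.
have {}h2 : M <= digits a 1 + digits a 0 by apply: h2.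
have {}h3 : M <= digits a 0 + digits a 0 by apply: h3.
have [e|ne] := eqVneq (digits a 0 + digits a 0) M.
  by apply: coded_degenerate => //; left.
have a0 : M < digits a 0 + digits a 0 by rewrite ltn_neqAle eq_sym ne.
have [e|ne2] := eqVneq (digits a 0 + digits a 0) M.+1; last first.
  apply: (@coded_nondegenerate M 1) => //; split; last by left.
  by split=> // [_|i]; lia.
have [e1|ne1] := eqVneq (digits a 1) (digits a 0).
  apply: (@coded_nondegenerate M 2) => //; split; last by right.
  split=> // i i0 i2 h; have := h 0; rewrite (_ : i = 1); last by lia.
  by rewrite addn0 => /(_ isT); lia.
by apply: coded_degenerate => //; right; lia.
Qed.

Theorem proposition3p8 (R : realType) (M : nat) (q : R) (hq : calI M q) :
  coded (bfVq M q).
Proof.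
by have [_ irr] := hq; exact: (coded_lex_shift irr).
Qed.
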